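(* If $\Theta(\mathbb F,\mathbf P)$ and $\mathcal I(\mathbf P)$ are both non-empty, then $\Theta(\mathbb F,\mathbf P)\cap\mathcal I(\mathbf P)\neq\emptyset$.
   Context: $(\Omega,\mathcal G,\mathbb F=(\mathcal F_t)_{t\ge0},\mathbf P)$ is a filtered probability space satisfying the usual assumptions. $\tau:\Omega\to[0,\infty]$ is a random time (a $\mathcal G$-measurable random variable). The progressively enlarged filtration is $\mathbb G=(\mathcal G_t)_{t\ge0}$, $\mathcal G_t=\bigcap_{s>t}(\mathcal F_s\vee\sigma(\tau\wedge s))$. ''$\mathbb F$ is immersed in $\mathbb G$ under $\mathbf Q$'' means: every $(\mathbb F,\mathbf Q)$-martingale is a $(\mathbb G,\mathbf Q)$-martingale. $\mathcal I(\mathbf P)$ is the set of all probability measures $\mathbf Q$ on $\mathcal G$ that are equivalent to $\mathbf P$ and such that $\mathbb F$ is immersed in $\mathbb G$ under $\mathbf Q$. $S=(S^1,\dots,S^n)$ is a vector of $\mathbb F$-adapted semimartingales (asset prices) and $S^0$ is the (strictly positive, $\mathbb F$-adapted) locally risk-free asset used as numéraire. $\Theta(\mathbb F,\mathbf P)$ is the set of equivalent local martingale measures: all probability measures $\mathbf Q$ on $\mathcal G$ with $\mathbf Q\sim\mathbf P$ on $\mathcal G$ such that $\frac{S}{S^0}=\left(\frac{S^1}{S^0},\dots,\frac{S^n}{S^0}\right)$ is an $(\mathbb F,\mathbf Q)$-local martingale. *)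

(* Defs.v *)
From HB Require Import structures.
From mathcomp Require Import all_boot all_order all_algebra.
From mathcomp Require Import all_classical all_reals all_analysis measurable_realfun.

Set Implicit Arguments.
Unset Strict Implicit.
Unset Printing Implicit Defensive.

Import Order.TTheory GRing.Theory Num.Theory.
Import numFieldNormedType.Exports.

Local Open Scope classical_set_scope.
Local Open Scope ring_scope.

(* Conventions. The sigma-algebra of the probability space is the canonical
   one of the measurableType T. Time is [0, +oo[: processes and filtrations are
   indexed by the reals and every condition is restricted to times t >= 0;
   values at negative times are irrelevant. *)

Section Filtrations.
Context d (T : measurableType d) (R : realType).
Implicit Types (P Q : probability T R) (F : R -> set_system T).

Definition filtration F : Prop :=
  [/\ forall t : R, 0 <= t -> sigma_algebra setT (F t),
      forall t : R, 0 <= t -> F t `<=` measurable &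
      forall s t : R, 0 <= s -> s <= t -> F s `<=` F t].

(* Right-continuity and completeness: F 0 contains all P-negligible sets
   (hence so does the ambient sigma-algebra). *)
Definition usual_conditions P F : Prop :=
  [/\ filtration F,
      forall t : R, 0 <= t -> F t = \bigcap_(s in [set s | t < s]) F s &
      forall N, P.-negligible N -> F 0 N].

Definition sigma_of d' (U : measurableType d') (f : T -> U) : set_system T :=
  preimage_set_system setT f measurable.

Definition progressive_enlargement F (tau : T -> \bar R) : R -> set_system T :=
  fun t => \bigcap_(s in [set s | t < s])
    <<s F s `|` sigma_of (fun w => Order.min (tau w) s%:E) >>.

Definition equivalent_measures P Q : Prop := P `<< Q /\ Q `<< P.

End Filtrations.

Section Processes.
Context d (T : measurableType d) (R : realType).
Implicit Types (P Q : probability T R) (F : R -> set_system T).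
Implicit Types (H : set_system T) (X Y M A : R -> T -> R).

Definition adapted F X : Prop := forall t : R, 0 <= t -> sigma_of (X t) `<=` F t.

(* g is a version of the conditional expectation E_Q[f | H]. *)
Definition is_cond_exp Q H (f g : T -> R) : Prop :=
  [/\ sigma_of g `<=` H,
      Q.-integrable setT (EFin \o g) &
      forall B, H B ->
        (\int[Q]_(w in B) (f w)%:E = \int[Q]_(w in B) (g w)%:E)%E].

Definition martingale F Q X : Prop :=
  [/\ adapted F X,
      forall t : R, 0 <= t -> Q.-integrable setT (EFin \o X t) &
      forall s t : R, 0 <= s -> s <= t -> is_cond_exp Q (F s) (X t) (X s)].

Definition cadlag (x : R -> R) : Prop :=
  (forall t : R, 0 <= t -> x s @[s --> t^'+] --> x t) /\
  (forall t : R, 0 < t -> cvg (x s @[s --> t^'-])).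

Definition cadlag_paths Q X : Prop :=
  {ae Q, forall w, cadlag (fun t => X t w)}.

Definition indistinguishable Q X Y : Prop :=
  {ae Q, forall w, forall t : R, 0 <= t -> X t w = Y t w}.

Definition stopping_time F (sigma : T -> \bar R) : Prop :=
  (forall w, (0 <= sigma w)%E) /\
  (forall t : R, 0 <= t -> F t [set w | (sigma w <= t%:E)%E]).

Definition stopped X (sigma : T -> \bar R) : R -> T -> R :=
  fun t w => X (fine (Order.min t%:E (sigma w))) w.

(* The factor 1_{sigma_k > 0} allows a non-integrable initial value. *)
Definition local_martingale F Q X : Prop :=
  [/\ adapted F X, cadlag_paths Q X &
      exists sigma : nat -> T -> \bar R,
        [/\ forall k, stopping_time F (sigma k),
            {ae Q, forall w, {homo sigma^~ w : k l / (k <= l)%N >-> (k <= l)%E}},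
            {ae Q, forall w, sigma k w @[k --> \oo] --> +oo%E} &
            forall k, martingale F Q (fun t w =>
              stopped X (sigma k) t w * ((0 < sigma k w)%E)%:R)]].

Definition finite_variation_paths Q X : Prop :=
  {ae Q, forall w, forall t : R, 0 <= t -> bounded_variation 0 t (fun s => X s w)}.

Definition semimartingale F Q X : Prop :=
  [/\ adapted F X, cadlag_paths Q X &
      exists M A,
        [/\ local_martingale F Q M /\ (forall w, M 0 w = 0),
            [/\ adapted F A, cadlag_paths Q A & finite_variation_paths Q A],
            forall w, A 0 w = 0 &
            indistinguishable Q X (fun t w => X 0 w + M t w + A t w)]].

Definition predictable_sigma F : set_system (R * T) :=
  <<s [set z : R * T | 0 <= z.1],
      [set [set 0%R] `*` B | B in F 0] `|`
      [set C | exists (s t : R) (B : set T),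
         [/\ 0 <= s, s <= t, F s B & C = [set` `]s, t] ] `*` B]] >>.

Definition predictable F X : Prop := forall B : set R, measurable B ->
  predictable_sigma F [set z : R * T | 0 <= z.1 /\ B (X z.1 z.2)].

(* Strictly positive, and locally risk-free: predictable (up to
   indistinguishability) with paths of finite variation. This covers in
   particular the money market account exp (\int_0^t r_s ds). *)
Definition locally_risk_free_asset F P X : Prop :=
  [/\ forall (t : R) w, 0 <= t -> 0 < X t w,
      adapted F X,
      cadlag_paths P X,
      finite_variation_paths P X &
      exists2 Y, predictable F Y & indistinguishable P X Y].

Definition immersed F (G : R -> set_system T) Q : Prop :=
  forall X, martingale F Q X -> martingale G Q X.

Definition immersion_measures F (tau : T -> \bar R) P : set (probability T R) :=
  [set Q | equivalent_measures Q P /\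
           immersed F (progressive_enlargement F tau) Q].

Definition elmm n (S : 'I_n -> R -> T -> R) (S0 : R -> T -> R) F P :
    set (probability T R) :=
  [set Q | equivalent_measures Q P /\
           forall i, local_martingale F Q (fun t w => S i t w / S0 t w)].

End Processes.

(* Main.v *)
(* Immersion under P2 is used as conditional independence: for B in G_s there is
   an F_s-measurable b (namely P2(B | F_s)) such that int_B f dP2 = int f b dP2
   for every nonnegative F_oo-measurable f. Let P1 be a local martingale
   measure, P2 an immersion measure, and z the density of P1 with respect to P2
   on F_oo. Then Q = z P2 coincides with P1 on F_oo, so the F-local martingales
   of P1 remain F-local martingales under Q; and since z is F_oo-measurable it
   can be absorbed into f, so the conditional independence holds under Q with
   the same b. Finally, testing an (F,Q)-martingale against b instead of the
   indicator of B shows that it is a (G,Q)-martingale. *)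
From HB Require Import structures.
Require Import Defs.
From mathcomp Require Import all_boot all_order all_algebra.
From mathcomp Require Import all_classical all_reals all_analysis measurable_realfun.
From mathcomp Require Import lra.

Import Order.TTheory GRing.Theory Num.Theory.

Local Open Scope classical_set_scope.
Local Open Scope ring_scope.

Set Implicit Arguments.
Unset Strict Implicit.
Unset Printing Implicit Defensive.

(** * Finite measures given by a density *)

Section Density.
Context d (T : measurableType d) (R : realType).
Local Open Scope ereal_scope.

(** Integrability of [z] makes the new measure finite, as the Radon-Nikodym results used below
    require. *)
Lemma exists_density (mu : {measure set T -> \bar R}) (z : T -> \bar R) :
  (forall x, 0 <= z x) -> mu.-integrable setT z ->
  exists nu : {finite_measure set T -> \bar R},
    forall A, nu A = \int[mu]_(x in A) z x.
Proof.
move=> z0 iz.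
pose nu A := \int[mu]_(x in A) z x.
have nu_set0 : nu set0 = 0 by rewrite /nu integral_set0.
have nu_ge0 A : 0 <= nu A by exact: integral_ge0.
have nu_add : semi_sigma_additive nu.
  move=> F mF tF mUF; rewrite /nu ge0_integral_bigcup//; last first.
    exact/measurable_funTS/measurable_int/iz.
  by apply: is_cvg_ereal_nneg_natsum => n _; exact: integral_ge0.
have nu_fin : fin_num_fun nu.
  move=> A mA; rewrite ge0_fin_numE//.
  exact/integrable_lty/(integrableS measurableT mA (@subsetT _ _) iz).
pose nuM : {measure set T -> \bar R} :=
  HB.pack nu (isMeasure.Build _ _ _ nu nu_set0 nu_ge0 nu_add).
pose nuF := HB.pack_for {finite_measure set T -> \bar R} (Measure.sort nuM)
  (Measure_isFinite.Build _ _ _ (Measure.sort nuM) nu_fin).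
by exists nuF.
Qed.

(** The Radon-Nikodym derivative of [nu] and [z] have the same integral over every measurable set,
    hence agree [mu]-almost everywhere; the change of variables for the derivative then holds for
    [z]. *)
Lemma ge0_integral_density (mu nu : {finite_measure set T -> \bar R})
    (z f : T -> \bar R) :
  (forall x, 0 <= z x) -> mu.-integrable setT z ->
  (forall A, measurable A -> nu A = \int[mu]_(x in A) z x) ->
  (forall x, 0 <= f x) -> measurable_fun setT f ->
  \int[nu]_x f x = \int[mu]_x (f x * z x).
Proof.
move=> z0 iz nuE f0 mf.
have mz := measurable_int _ iz.
have numu : nu `<< mu.
  apply/null_content_dominatesP => A mA muA0; rewrite nuE//.
  by rewrite -[RHS](integral_abs_eq0 mA (measurable_funTS mz) muA0);
    apply: eq_integral => x _; rewrite gee0_abs.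
have mrn : measurable_fun setT (Radon_Nikodym_SigmaFinite.f nu mu).
  exact/measurable_int/Radon_Nikodym_SigmaFinite.f_integrable.
rewrite -(Radon_Nikodym_SigmaFinite.change_of_variables numu f0 measurableT mf).
apply: ge0_ae_eq_integral => //.
- exact: emeasurable_funM.
- exact: emeasurable_funM.
- by move=> x _; rewrite mule_ge0// Radon_Nikodym_SigmaFinite.f_ge0.
- by move=> x _; rewrite mule_ge0.
apply: ae_eqe_mul2l; apply: integral_ae_eq => //.
  exact: Radon_Nikodym_SigmaFinite.f_integrable.
by move=> A _ mA; rewrite -nuE// -Radon_Nikodym_SigmaFinite.f_integral.
Qed.

End Density.

(** * Restriction of measures to a sub-sigma-algebra *)

Section SubSigmaAlgebra.
Context d (T : measurableType d) (R : realType) (H : set_system T).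
Hypothesis Hm : H `<=` measurable.
Local Open Scope ereal_scope.
Local Notation TH := (g_sigma_algebraType H).

Lemma g_sigma_algebra_measurable A : <<s H >> A -> measurable A.
Proof. by apply: smallest_sub => //; exact: sigma_algebra_measurable. Qed.

Lemma measurable_fun_g_sigma d' (U : measurableType d') (f : T -> U) :
  measurable_fun [set: TH] f -> measurable_fun [set: T] f.
Proof.
move=> mf _ B mB; rewrite setTI; apply: g_sigma_algebra_measurable.
by have := mf measurableT _ mB; rewrite setTI.
Qed.

Lemma measurable_id_g_sigma : measurable_fun [set: T] (id : T -> TH).
Proof. by move=> _ B /g_sigma_algebra_measurable mB; rewrite setTI. Qed.

(** The restriction is the pushforward under the identity from [T] to [TH], so the integral formula
    is the change of variables for pushforwards. *)
Lemma exists_restriction_g_sigma (m : {finite_measure set T -> \bar R}) :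
  exists mH : {finite_measure set TH -> \bar R},
    (forall A, mH A = m A) /\
    forall (D : set T) (f : T -> \bar R), <<s H >> D ->
      measurable_fun [set: TH] f -> (forall x, 0 <= f x) ->
      \int[mH]_(x in D) f x = \int[m]_(x in D) f x.
Proof.
pose mid := measurable_id_g_sigma.
pose mM : {measure set TH -> \bar R} :=
  measure_function_pushforward__canonical__measure_function_Measure m mid.
have mfin : fin_num_fun mM.
  by move=> A /g_sigma_algebra_measurable; exact: fin_num_measure.
pose mH := HB.pack_for {finite_measure set TH -> \bar R} (Measure.sort mM)
  (Measure_isFinite.Build _ _ _ (Measure.sort mM) mfin).
exists mH; split=> // D f HD mf f0.
by rewrite (ge0_integral_pushforward mid)//; exact/measurable_funTS.
Qed.

Lemma eq_integral_g_sigma (m1 m2 : {finite_measure set T -> \bar R})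
    (f : T -> \bar R) (D : set T) : (forall A, <<s H >> A -> m1 A = m2 A) ->
  <<s H >> D -> measurable_fun [set: TH] f ->
  \int[m1]_(x in D) f x = \int[m2]_(x in D) f x.
Proof.
move=> m12 HD mf; rewrite integralE [RHS]integralE.
have [n1 [n1E i1]] := exists_restriction_g_sigma m1.
have [n2 [n2E i2]] := exists_restriction_g_sigma m2.
have n12 A : @measurable _ TH A -> A `<=` D -> n1 A = n2 A.
  by move=> mA _; rewrite n1E n2E; exact: m12.
have mp := measurable_funepos mf; have mn := measurable_funeneg mf.
by rewrite -(i1 _ _ HD mp)// -(i1 _ _ HD mn)// -(i2 _ _ HD mp)//
  -(i2 _ _ HD mn)//; congr (_ - _); exact: eq_measure_integral.
Qed.

Lemma eq_integrable_g_sigma (m1 m2 : {finite_measure set T -> \bar R})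
    (f : T -> \bar R) : (forall A, <<s H >> A -> m1 A = m2 A) ->
  measurable_fun [set: TH] f ->
  m1.-integrable setT f -> m2.-integrable setT f.
Proof.
move=> m12 mf /integrableP[mf' fi]; apply/integrableP; split=> //.
rewrite -(eq_integral_g_sigma m12)//; first exact: (@measurableT _ TH).
exact: measurableT_comp.
Qed.

(** Radon-Nikodym is applied to the two restrictions, which makes [z] measurable for the small
    sigma-algebra; [fine] makes it real-valued. *)
Lemma exists_density_g_sigma (nu mu : {finite_measure set T -> \bar R}) :
  (forall A, <<s H >> A -> mu A = 0 -> nu A = 0) ->
  exists z : T -> R, [/\ forall x, (0 <= z x)%R,
    measurable_fun [set: TH] z, mu.-integrable setT (EFin \o z) &
    forall f : T -> \bar R, (forall x, 0 <= f x) ->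
      measurable_fun [set: TH] f ->
      \int[nu]_x f x = \int[mu]_x (f x * (z x)%:E)].
Proof.
move=> dom.
have [nuH [nuE inu]] := exists_restriction_g_sigma nu.
have [muH [muE imu]] := exists_restriction_g_sigma mu.
have numuH : nuH `<< muH.
  apply/null_content_dominatesP => A mA muA0.
  by rewrite [LHS]nuE; apply: dom => //; rewrite -muE.
pose z := Radon_Nikodym_SigmaFinite.f nuH muH.
have z0 x : 0 <= z x by exact: Radon_Nikodym_SigmaFinite.f_ge0.
have zE : EFin \o (fine \o z) = z.
  apply/funext => x /=; rewrite fineK//.
  exact: Radon_Nikodym_SigmaFinite.f_fin_num.
have /integrableP[mz iz] : muH.-integrable setT z.
  exact: Radon_Nikodym_SigmaFinite.f_integrable.
have HT : <<s H >> [set: T] by exact: (@measurableT _ TH).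
exists (fine \o z); split.
- by move=> x; exact: fine_ge0.
- exact: measurableT_comp.
- rewrite zE; apply/integrableP; split; first exact: measurable_fun_g_sigma mz.
  by rewrite -imu//; exact: measurableT_comp.
move=> f f0 mf; rewrite -inu//.
rewrite -(Radon_Nikodym_SigmaFinite.change_of_variables numuH f0 HT mf).
rewrite imu//.
- by apply: eq_integral => x _; rewrite -[in LHS]/(z x) -zE.
- exact: emeasurable_funM.
- by move=> x; rewrite mule_ge0.
Qed.

End SubSigmaAlgebra.

(** * Martingales, conditional probabilities and immersion *)

Section Martingales.
Context d (T : measurableType d) (R : realType).
Implicit Types (P Q : probability T R) (F G : R -> set_system T).
Local Open Scope ereal_scope.
Local Notation measurable_wrt H f :=
  (measurable_fun [set: g_sigma_algebraType H] f).

Lemma integral_indicM (mu : {measure set T -> \bar R}) (D : set T)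
    (f : T -> \bar R) :
  \int[mu]_(x in D) f x = \int[mu]_x (f x * (\1_D x)%:E).
Proof. by rewrite integral_mkcond epatch_indic. Qed.

Lemma sigma_of_subP (H : set_system T) d' (U : measurableType d') (f : T -> U) :
  sigma_algebra setT H -> sigma_of f `<=` H <-> measurable_wrt H f.
Proof.
move=> sH; have HE : <<s H >> = H by exact: sigma_algebra_id.
split=> [fH _ B mB|mf _ [B mB <-]].
  by rewrite /measurable/= HE; apply: fH; exists B.
by have := mf measurableT B mB; rewrite /measurable/= HE.
Qed.

Lemma measurable_fun_g_sigmaS (H K : set_system T) d' (U : measurableType d')
    (f : T -> U) :
  H `<=` K -> measurable_wrt H f -> measurable_wrt K f.
Proof.
move=> HK mf _ B mB; apply: (sub_smallest2r _ HK).
  exact: smallest_sigma_algebra.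
exact: mf.
Qed.

(* Moving the negative parts across turns an equality of signed integrals into
   an equality of masses of positive measures. *)
Lemma eq_integral_pos_neg (mu : {measure set T -> \bar R}) (D : set T)
    (f g : T -> \bar R) : measurable D ->
  mu.-integrable D f -> mu.-integrable D g ->
  \int[mu]_(x in D) f x = \int[mu]_(x in D) g x <->
  \int[mu]_(x in D) (f^\+ x + g^\- x) = \int[mu]_(x in D) (g^\+ x + f^\- x).
Proof.
move=> mD fi gi.
have [fp fn] := (integrable_funepos mD fi, integrable_funeneg mD fi).
have [gp gn] := (integrable_funepos mD gi, integrable_funeneg mD gi).
rewrite !integralD// (integralE _ _ f) (integralE _ _ g).
have fin h : mu.-integrable D h -> exists r, \int[mu]_(x in D) h x = r%:E.
  move=> hi; exists (fine (\int[mu]_(x in D) h x)).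
  by rewrite fineK// integrable_fin_num.
have [[a ->] [b ->]] := (fin _ fp, fin _ fn).
have [[a' ->] [b' ->]] := (fin _ gp, fin _ gn).
by rewrite -!EFinB -!EFinD; split=> -[abE]; congr EFin; lra.
Qed.

(** [a] is a version of P(A | H), obtained as the density on [<<s H >>] of the measure sending B to
    the mass of A and B together. *)
Lemma exists_cond_prob P (H : set_system T) (A : set T) :
  H `<=` measurable -> measurable A ->
  exists a : T -> R, [/\ forall x, (0 <= a x)%R,
    measurable_wrt H a, P.-integrable setT (EFin \o a) &
    forall f : T -> \bar R, (forall x, 0 <= f x) -> measurable_wrt H f ->
      \int[P]_(x in A) f x = \int[P]_x (f x * (a x)%:E)].
Proof.
move=> Hm mA.
have z0 x : 0 <= (\1_A x : R)%:E by rewrite lee_fin.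
have iz : P.-integrable setT (EFin \o \1_A) by exact: integrable_indic.
have [nu nuE] := exists_density z0 iz.
have [|a [a0 ma ia aE]] := exists_density_g_sigma Hm (nu := nu) (mu := P).
  move=> B /(g_sigma_algebra_measurable Hm) mB PB0.
  rewrite nuE integral_indic//.
  by apply: subset_measure0 PB0 => //; exact: measurableI.
exists a; split=> // f f0 mf; rewrite -aE// integral_indicM.
by rewrite (ge0_integral_density z0 iz)//; exact: measurable_fun_g_sigma mf.
Qed.

(* Only a pi-system: the sigma-algebra F_oo is <<s terminal_events F >>. *)
Definition terminal_events F : set_system T :=
  \bigcup_(t in [set t | (0 <= t)%R]) F t.

(** For a filtration F and G of measurable events, this says that Q(B | F_oo) has an F_s-measurable
    version: the H-hypothesis in its conditional form. *)
Definition cond_indep_terminal F G Q := forall s B, (0 <= s)%R -> G s B ->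
  exists b : T -> R, [/\ forall x, (0 <= b x)%R,
    measurable_wrt (F s) b &
    forall f : T -> \bar R, (forall x, 0 <= f x) ->
      measurable_wrt (terminal_events F) f ->
      \int[Q]_(x in B) f x = \int[Q]_x (f x * (b x)%:E)].

Lemma sub_terminal_events F t : (0 <= t)%R -> F t `<=` terminal_events F.
Proof. by move=> t0 A FA; exists t. Qed.

Lemma terminal_events_measurable F :
  filtration F -> terminal_events F `<=` measurable.
Proof. by move=> [_ Fm _] A [t /= t0 FA]; exact: Fm FA. Qed.

Lemma adapted_measurable_terminal F X t : filtration F -> adapted F X ->
  (0 <= t)%R -> measurable_wrt (terminal_events F) (EFin \o X t).
Proof.
move=> [Fs _ _] aX t0; apply/measurable_EFinP.
apply: (measurable_fun_g_sigmaS (@sub_terminal_events F t t0)).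
by apply/(sigma_of_subP _ (Fs _ t0)); exact: aX.
Qed.

(** Both sides integrate [f] against finite measures, with densities [\1_B] and [b]. It suffices
    that these agree on F_oo, hence on the pi-system [terminal_events F]. *)
Lemma immersed_cond_indep_terminal F G P : filtration F ->
  (forall t, (0 <= t)%R -> G t `<=` measurable) ->
  immersed F G P -> cond_indep_terminal F G P.
Proof.
move=> hF Gm imm s B s0 GB; have [Fs Fm Fmono] := hF.
have mB : measurable B by exact: Gm GB.
have [b [b0 mb ib bE]] := exists_cond_prob P (Fm _ s0) mB.
exists b; split=> // f f0 mf.
have mf' := measurable_fun_g_sigma (terminal_events_measurable hF) mf.
have z0 x : 0 <= (\1_B x : R)%:E by rewrite lee_fin.
have iz : P.-integrable setT (EFin \o \1_B) by exact: integrable_indic.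
have b0' x : 0 <= (b x)%:E by rewrite lee_fin.
have [nuB nuBE] := exists_density z0 iz.
have [nub nubE] := exists_density b0' ib.
rewrite integral_indicM -(ge0_integral_density z0 iz (fun A _ => nuBE A))//.
rewrite -(ge0_integral_density b0' ib (fun A _ => nubE A))//.
apply: (eq_integral_g_sigma (terminal_events_measurable hF)) mf;
  last exact: (@measurableT _ (g_sigma_algebraType _)).
have FT t : (0 <= t)%R -> F t setT.
  by move=> t0; have [F0 FC _] := Fs t t0; have := FC _ F0; rewrite setD0.
apply: (@g_sigma_algebra_measure_unique _ _ _ (terminal_events F)
  (terminal_events_measurable hF) (fun=> setT)).
- by move=> _; exists 0%R => //=; exact: FT.
- by apply/seteqP; split=> // x _; exists 0%N.
- move=> A C [t /= t0 FA] [u /= u0 FC]; exists (Num.max t u).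
    by rewrite /= le_max t0.
  have m0 : (0 <= Num.max t u)%R by rewrite le_max t0.
  rewrite /= -(sigma_algebra_id (Fs _ m0)).
  apply: (@measurableI _ (g_sigma_algebraType _)); apply: sub_sigma_algebra.
    by apply: Fmono FA => //; rewrite le_max lexx.
  by apply: Fmono FC => //; rewrite le_max lexx orbT.
- move=> A [u0 /= u00 FA0].
  (* The martingale property will be used between [s] and [u], so [u] must dominate both [s] and the
     time at which A is known. *)
  pose u := Num.max s u0.
  have su : (s <= u)%R by rewrite le_max lexx.
  have u_ge0 : (0 <= u)%R := le_trans s0 su.
  have FA : F u A by apply: Fmono FA0 => //; rewrite le_max lexx orbT.
  have mA : measurable A := Fm _ u_ge0 _ FA.
  (* M is a version of the martingale P(A | F_r); it is exactly \1_A from u on,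
     so that the immersion hypothesis applies to the event A itself. *)
  have /choice[M hM] : forall r, exists a : T -> R, (0 <= r)%R ->
      [/\ (u <= r)%R -> a = \1_A, forall x, (0 <= a x)%R,
        measurable_wrt (F r) a, P.-integrable setT (EFin \o a) &
        forall f : T -> \bar R, (forall x, 0 <= f x) ->
          measurable_wrt (F r) f ->
          \int[P]_(x in A) f x = \int[P]_x (f x * (a x)%:E)].
    move=> r; have [ur|ru] := leP u r.
      exists \1_A => r0; split=> //.
      - apply: (@measurable_indic _ (g_sigma_algebraType (F r))).
        by apply: sub_sigma_algebra; exact: Fmono FA.
      - exact: integrable_indic.
      - by move=> g g0 mg; rewrite integral_indicM.
    (* At negative times the requirement is vacuous and 0 is a placeholder. *)
    have [r0|r0] := leP 0%R r; last by exists (fun=> 0%R).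
    have [a [a0 ma ia aE]] := exists_cond_prob P (Fm _ r0) mA.
    by exists a => _; split=> //; rewrite leNgt ru.
  have martM : martingale F P M.
    split.
    - move=> t t0; have [_ _ mM _ _] := hM t t0.
      by apply/sigma_of_subP => //; exact: Fs.
    - by move=> t t0; have [] := hM t t0.
    - move=> r t r0 rt; have t0 := le_trans r0 rt.
      have [_ _ mMr iMr Mr] := hM r r0; have [_ _ _ _ Mt] := hM t t0.
      split=> //; first by apply/sigma_of_subP => //; exact: Fs.
      (* Testing [M r] and [M t] against [\1_C] gives the mass of A and C together in both cases. *)
      move=> C FC; have FtC := Fmono _ _ r0 rt _ FC.
      have mC (q : R) : F q C ->
          measurable_wrt (F q) (fun x => (\1_C x : R)%:E).
        move=> FqC; apply/measurable_EFinP.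
        apply: (@measurable_indic _ (g_sigma_algebraType (F q))).
        exact: sub_sigma_algebra.
      have C0 x : 0 <= (\1_C x : R)%:E by rewrite lee_fin.
      rewrite integral_indicM [RHS]integral_indicM.
      under eq_integral do rewrite muleC.
      under [RHS]eq_integral do rewrite muleC.
      by rewrite -Mt ?Mr//; exact: mC.
  (* The chain is: mass of A and B together = int_B M_u = int_B M_s = int M_s b = int_A b, by
     immersion, the choice of b, and the choice of M_s. *)
  have [_ _ /(_ s u s0 su)[_ _ /(_ B GB)]] := imm M martM.
  have [-> // _ _ _ _] := hM u u_ge0.
  have [_ Ms0 mMs _ MsE] := hM s s0.
  rewrite (bE (EFin \o M s))//; last exact/measurable_EFinP.
  under [X in _ = X -> _]eq_integral do rewrite muleC.
  rewrite -(MsE (EFin \o b))//; last exact/measurable_EFinP.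
  rewrite nubE nuBE => <-; rewrite integral_indicM [RHS]integral_indicM.
  by apply: eq_integral => x _; rewrite muleC.
- by move=> _; rewrite ltey_eq fin_num_measure.
Qed.

Lemma cond_indep_terminal_density F G P Q (z : T -> R) : filtration F ->
  (forall t, (0 <= t)%R -> G t `<=` measurable) ->
  (forall x, (0 <= z x)%R) -> measurable_wrt (terminal_events F) z ->
  P.-integrable setT (EFin \o z) ->
  (forall A, measurable A -> Q A = \int[P]_(x in A) (z x)%:E) ->
  cond_indep_terminal F G P -> cond_indep_terminal F G Q.
Proof.
move=> hF Gm z0 mz iz QE ciP s B s0 GB.
have Fm := terminal_events_measurable hF.
have [b [b0 mb bE]] := ciP s B s0 GB.
have mB : measurable B by exact: Gm GB.
exists b; split=> // f f0 mf.
have z0' x : 0 <= (z x)%:E by rewrite lee_fin.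
have mf' := measurable_fun_g_sigma Fm mf.
have mb' : measurable_fun setT b.
  by have [_ Fm' _] := hF; exact: measurable_fun_g_sigma (Fm' _ s0) _ _ _ mb.
rewrite integral_indicM !(ge0_integral_density z0' iz QE)//; last 4 first.
- by move=> x; rewrite mule_ge0// lee_fin.
- by apply: emeasurable_funM => //; exact/measurable_EFinP.
- by move=> x; rewrite mule_ge0// lee_fin.
- by apply: emeasurable_funM => //; exact/measurable_EFinP/measurable_indic.
(* Regrouped so that the test function is [f] times [z], to which [bE] applies. *)
under eq_integral do rewrite muleAC.
rewrite -integral_indicM bE; last 2 first.
- by move=> x; rewrite mule_ge0.
- by apply: emeasurable_funM => //; exact/measurable_EFinP.
by apply: eq_integral => x _; rewrite muleAC.
Qed.

Lemma cond_indep_terminal_immersed F G Q : filtration F ->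
  (forall t, (0 <= t)%R -> F t `<=` G t) ->
  (forall t, (0 <= t)%R -> G t `<=` measurable) ->
  cond_indep_terminal F G Q -> immersed F G Q.
Proof.
move=> hF FG Gm ci X [aX iX cX]; have [Fs Fm Fmono] := hF.
split=> // [t t0|s t s0 st]; first exact: subset_trans (aX t t0) (FG t t0).
have t0 := le_trans s0 st; have [_ _ XE] := cX s t s0 st.
split; [exact: subset_trans (aX s s0) (FG s s0)|exact: iX|move=> B GB].
have [b [b0 mb bE]] := ci s B s0 GB.
have mX r := adapted_measurable_terminal (t := r) hF aX.
have Xint r D : (0 <= r)%R -> measurable D -> Q.-integrable D (EFin \o X r).
  by move=> r0 mD; exact: integrableS (iX r r0).
have [it is_] := (iX t t0, iX s s0).
have [mt ms] := (mX t t0, mX s s0).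
have [mtp mtn] := (measurable_funepos mt, measurable_funeneg mt).
have [msp msn] := (measurable_funepos ms, measurable_funeneg ms).
(* The property int_B X_t = int_B X_s amounts to int_B p = int_B q with nonnegative [p] and [q]; the
   possibly unbounded [b] is then integrated only against the positive finite measures p Q and q
   Q. *)
pose p x := (EFin \o X t)^\+ x + (EFin \o X s)^\- x.
pose q x := (EFin \o X s)^\+ x + (EFin \o X t)^\- x.
have mp : measurable_wrt (terminal_events F) p by exact: emeasurable_funD.
have mq : measurable_wrt (terminal_events F) q by exact: emeasurable_funD.
have p0 x : 0 <= p x by rewrite adde_ge0.
have q0 x : 0 <= q x by rewrite adde_ge0.
have ip : Q.-integrable setT p.
  apply: integrableD => //; first exact: integrable_funepos.
  exact: integrable_funeneg.
have iq : Q.-integrable setT q.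
  apply: integrableD => //; first exact: integrable_funepos.
  exact: integrable_funeneg.
have mB : measurable B by exact: Gm GB.
apply/(eq_integral_pos_neg mB (Xint t B t0 mB) (Xint s B s0 mB)).
rewrite -/(p _) (bE p p0 mp) (bE q q0 mq).
have [np npE] := exists_density p0 ip.
have [nq nqE] := exists_density q0 iq.
have b0' x : 0 <= (EFin \o b) x by rewrite lee_fin.
have mb1 : measurable_wrt (F s) (EFin \o b) by exact/measurable_EFinP.
have mb' := measurable_fun_g_sigma (Fm s s0) mb1.
under eq_integral do rewrite muleC.
under [RHS]eq_integral do rewrite muleC.
rewrite -(ge0_integral_density p0 ip (fun A _ => npE A) b0' mb').
rewrite -(ge0_integral_density q0 iq (fun A _ => nqE A) b0' mb').
apply: (eq_integral_g_sigma (Fm s s0)) mb1;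
  last exact: (@measurableT _ (g_sigma_algebraType _)).
(* p Q and q Q agree on F_s: this is the F-martingale property of X, rearranged. *)
move=> A; rewrite (sigma_algebra_id (Fs s s0)) => FA.
rewrite npE nqE; have mA := Fm s s0 A FA.
by apply/(eq_integral_pos_neg mA (Xint t A t0 mA) (Xint s A s0 mA)); exact: XE.
Qed.

(** * Transfer of martingales between measures that agree on F_oo *)

Lemma eq_terminal_martingale F P Q X : filtration F ->
  (forall A, <<s terminal_events F >> A -> P A = Q A) ->
  martingale F P X -> martingale F Q X.
Proof.
move=> hF PQ [aX iX cX]; have Tm := terminal_events_measurable hF.
have mX r := adapted_measurable_terminal (t := r) hF aX.
have iXQ r : (0 <= r)%R -> Q.-integrable setT (EFin \o X r).
  by move=> r0; exact: (eq_integrable_g_sigma Tm PQ (mX r r0) (iX r r0)).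
split=> // s t s0 st; have t0 := le_trans s0 st.
split=> [||A FA]; [exact: aX|exact: iXQ|].
have TA : <<s terminal_events F >> A by apply: sub_sigma_algebra; exists s.
rewrite -(eq_integral_g_sigma Tm PQ TA (mX t t0)).
rewrite -(eq_integral_g_sigma Tm PQ TA (mX s s0)).
by have [_ _] := cX s t s0 st; exact.
Qed.

Lemma null_dominates_ae P Q (A : set T) :
  Q `<< P -> {ae P, forall x, A x} -> {ae Q, forall x, A x}.
Proof.
move=> /null_content_dominatesP QP [N [mN N0 AN]].
by exists N; split=> //; exact: QP.
Qed.

(** The same localizing sequence serves: its almost sure properties and those of the paths pass
    through [Q << P], the martingale property through agreement on F_oo. *)
Lemma eq_terminal_local_martingale F P Q X : filtration F -> Q `<< P ->
  (forall A, <<s terminal_events F >> A -> P A = Q A) ->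
  local_martingale F P X -> local_martingale F Q X.
Proof.
move=> hF QP PQ [aX cX [sigma [st hom cvg mart]]].
split=> //; first exact: null_dominates_ae QP cX.
exists sigma; split=> //.
- exact: null_dominates_ae QP hom.
- exact: null_dominates_ae QP cvg.
- by move=> k; exact: eq_terminal_martingale hF PQ (mart k).
Qed.

(** * The enlarged filtration and the new measure *)

Lemma sub_progressive_enlargement F (tau : T -> \bar R) t : filtration F ->
  (0 <= t)%R -> F t `<=` progressive_enlargement F tau t.
Proof.
move=> [_ _ Fmono] t0 A FA s /= ts; apply: sub_sigma_algebra; left.
by apply: Fmono FA => //; exact: ltW.
Qed.

Lemma progressive_enlargement_measurable F (tau : T -> \bar R) t :
  filtration F -> measurable_fun setT tau ->
  (0 <= t)%R -> progressive_enlargement F tau t `<=` measurable.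
Proof.
(* Any index beyond [t] bounds the intersection; [t + 1] is taken. *)
move=> [_ Fm _] mtau t0 A /(_ (t + 1)%R) /=.
rewrite ltrDl ltr01 => /(_ isT); apply: smallest_sub.
  exact: sigma_algebra_measurable.
move=> C [FC|[B mB <-]]; first by apply: Fm FC; rewrite addr_ge0.
by apply: (measurable_mine mtau (measurable_cst (t + 1)%:E)).
Qed.

(** P1 itself will not do as Q: its density with respect to P2 on all events need not be
    F_oo-measurable. *)
Lemma exists_equal_on_terminal F P1 P2 : filtration F ->
  P1 `<< P2 -> P2 `<< P1 ->
  exists (Q : probability T R) (z : T -> R),
  [/\ (forall x, (0 <= z x)%R) /\ measurable_wrt (terminal_events F) z,
      P2.-integrable setT (EFin \o z),
      forall A, measurable A -> Q A = \int[P2]_(x in A) (z x)%:E,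
      forall A, <<s terminal_events F >> A -> P1 A = Q A &
      equivalent_measures Q P2].
Proof.
move=> hF P12 P21; have Tm := terminal_events_measurable hF.
have [|z [z0 mz iz zE]] := exists_density_g_sigma Tm (nu := P1) (mu := P2).
  move=> A /(g_sigma_algebra_measurable Tm) mA P2A0.
  by move/null_content_dominatesP: P12; exact.
have z0' x : 0 <= (z x)%:E by rewrite lee_fin.
have [nu nuE] := exists_density z0' iz.
have nuP1 A : <<s terminal_events F >> A -> nu A = P1 A.
  move=> TA; have mA := g_sigma_algebra_measurable Tm TA.
  rewrite nuE integral_indicM -[in RHS](setIT A) -integral_indic// zE.
  - by apply: eq_integral => x _; rewrite muleC.
  - by move=> x; rewrite lee_fin.
  - apply/measurable_EFinP.
    exact: (@measurable_indic _ (g_sigma_algebraType _)).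
have TT : <<s terminal_events F >> setT.
  exact: (@measurableT _ (g_sigma_algebraType _)).
have nuT : nu setT = 1 by rewrite nuP1// probability_setT.
pose Q := HB.pack_for (probability T R) (Measure.sort nu)
  (Measure_isProbability.Build _ _ _ (Measure.sort nu) nuT).
exists Q, z; split=> //.
- by move=> A _; exact: nuE.
- by move=> A TA; rewrite -nuP1.
split; apply/null_content_dominatesP => A mA.
  move=> P2A0; rewrite [LHS]nuE.
  have mz' := measurable_fun_g_sigma Tm mz.
  rewrite -[RHS](integral_abs_eq0 (f := EFin \o z) mA _ P2A0).
    by apply: eq_integral => x _; rewrite gee0_abs//= lee_fin.
  exact/measurable_funTS/measurable_EFinP.
(* N is an F_oo-event of Q-mass 0, hence P1-null, hence P2-null. *)
move=> QA0; pose N := [set x | z x = 0%R].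
have TN : <<s terminal_events F >> N.
  by rewrite -[N]setTI; exact: (mz measurableT [set 0%R]).
have mN := g_sigma_algebra_measurable Tm TN.
have P2N0 : P2 N = 0.
  move/null_content_dominatesP: P21; apply => //.
  apply: (etrans (esym (nuP1 _ TN))); rewrite nuE.
  by rewrite (eq_integral (cst 0)) ?integral0// => x /[!inE] /= ->.
(* So [z] vanishes P2-almost everywhere on A, and A lies in N up to a null set [M]. *)
have : \int[P2]_(x in A) `|(z x)%:E| = 0.
  rewrite -[RHS]QA0 [RHS]nuE.
  by apply: eq_integral => x _; rewrite gee0_abs.
move/ae_eq_integral_abs => /(_ mA) [|M [mM M0 AM]].
  exact/measurable_funTS/measurable_EFinP/(measurable_fun_g_sigma Tm).
apply: (@subset_measure0 _ _ _ _ A (M `|` N)) => //.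
- exact: measurableU.
- move=> x Ax /=; have [zx0|zx0] := eqVneq (z x) 0%R; [by right|left].
  by apply: AM => /= /(_ Ax) [/eqP]; apply/negP.
- by apply: null_set_setU.
Qed.

End Martingales.

Theorem proposition4p5 (R : realType) (d : measure_display)
    (T : measurableType d) (P : probability T R)
    (F : R -> set_system T) (hF : usual_conditions P F)
    (tau : T -> \bar R) (tau_ge0 : forall w, (0 <= tau w)%E)
    (tau_meas : measurable_fun [set: T] tau)
    (n : nat) (S : 'I_n -> R -> T -> R)
    (hS : forall i, semimartingale F P (S i))
    (S0 : R -> T -> R) (hS0 : locally_risk_free_asset F P S0) :
  elmm S S0 F P !=set0 ->
  immersion_measures F tau P !=set0 ->
  (elmm S S0 F P `&` immersion_measures F tau P) !=set0.
Proof.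
have [filF _ _] := hF.
move=> [P1 [[P1P PP1] S_P1]] [P2 [[P2P PP2] imm_P2]].
have P12 := null_dominates_trans P1P PP2.
have P21 := null_dominates_trans P2P PP1.
have [Q [z [[z0 mz] iz QE QP1 [QP2 P2Q]]]] :=
  exists_equal_on_terminal filF P12 P21.
have Gm t : 0 <= t -> progressive_enlargement F tau t `<=` measurable.
  exact: progressive_enlargement_measurable.
have QP := null_dominates_trans QP2 P2P.
have PQ := null_dominates_trans PP2 P2Q.
exists Q; split; split=> //.
- move=> i; apply: eq_terminal_local_martingale (S_P1 i) => //.
  exact: null_dominates_trans QP PP1.
(* Backwards: immersion under P2 gives conditional independence under P2, then under Q through [z],
   then immersion under Q. *)
- apply: cond_indep_terminal_immersed => //.
    by move=> t; exact: sub_progressive_enlargement.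
  apply: cond_indep_terminal_density z0 mz iz QE _ => //.
  exact: immersed_cond_indep_terminal.
Qed.
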